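(* Let $\mathcal{K}\subseteq\mathbb{R}^k$ be a closed convex cone, and consider the mixed-integer conic problem $$\text{(MICONE)}\qquad \min_{x,z}\ c^Tz\quad\text{s.t. } A_xx+A_zz=b,\ L\le x\le U,\ x\in\mathbb{Z}^n,\ z\in\mathcal{K},$$ where $c\in\mathbb{R}^k$, $A_x$, $A_z$, $b$ are a vector and matrices of compatible dimensions and $L,U\in\mathbb{R}^n$ are finite bounds. Assume that, for every integer vector $\hat x$ encountered by the conic outer approximation (OA) algorithm described in the context, one of the following holds: (a) the continuous subproblem $CP(\hat x)$ is feasible and strong duality holds at the optimal primal-dual solution $(z_{\hat x},\beta_{\hat x},\lambda_{\hat x})$; or (b) $CP(\hat x)$ is infeasible and its dual is unbounded, such that there is a ray $(\beta_{\hat x},\lambda_{\hat x})$ satisfying $\beta_{\hat x}\in\mathcal{K}^*$, $\beta_{\hat x}=-A_z^T\lambda_{\hat x}$ and $\lambda_{\hat x}^T(b-A_x\hat x)>0$. Then finite termination of the conic OA algorithm is guaranteed, because integer solutions $\hat x$ cannot repeat and only a finite number of integer solutions is possible; that is, the algorithm iteratively builds up $T$ until convergence, in a finite number of steps, to the optimal solution.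
   Context: The dual cone of $\mathcal{K}\subseteq\mathbb{R}^k$ is $\mathcal{K}^*:=\{\beta\in\mathbb{R}^k:\beta^Tz\ge 0\ \ \forall z\in\mathcal{K}\}$. For $T\subseteq\mathcal{K}^*$, the outer approximation problem MIOA$(T)$ is $$\min_{x,z}\ c^Tz\quad\text{s.t. } A_xx+A_zz=b,\ L\le x\le U,\ x\in\mathbb{Z}^n,\ \beta^Tz\ge 0\ \ \forall\beta\in T.$$ For a fixed integer value $\hat x$, the continuous subproblem $CP(\hat x)$ is $$v_{\hat x}=\min_z\ c^Tz\quad\text{s.t. } A_zz=b-A_x\hat x,\ z\in\mathcal{K},$$ and its dual is $$\max_{\beta,\lambda}\ \lambda^T(b-A_x\hat x)\quad\text{s.t. }\beta=c-A_z^T\lambda,\ \beta\in\mathcal{K}^*.$$ Conic outer approximation (OA) algorithm. Initialize $z_U\leftarrow\infty$, $z_L\leftarrow-\infty$, $T\leftarrow\emptyset$, and fix a convergence tolerance $\epsilon$. While $z_U-z_L\ge\epsilon$, do the following: 1. Solve MIOA$(T)$. If MIOA$(T)$ is infeasible, then (MICONE) is infeasible, so terminate. 2. Let $(\hat x,\hat z)$ be the optimal solution of MIOA$(T)$, with objective value $w_T$. Update the lower bound $z_L\leftarrow w_T$. 3. Solve $CP(\hat x)$. If $CP(\hat x)$ is feasible, let $(z_{\hat x},\beta_{\hat x},\lambda_{\hat x})$ be an optimal primal-dual solution with objective value $v_{\hat x}$; if $v_{\hat x}<z_U$, set $z_U\leftarrow v_{\hat x}$ and record $(\hat x,z_{\hat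 x})$ as the best known solution. If instead $CP(\hat x)$ is infeasible, let $(\beta_{\hat x},\lambda_{\hat x})$ be a ray of the dual of $CP(\hat x)$. 4. Set $T\leftarrow T\cup\{\beta_{\hat x}\}$.
   Formalization: The tolerance ε is taken positive, and that the algorithm can always carry on until it terminates is claimed only if MIOA(∅) is infeasible or has an optimal solution; if MIOA(∅) is unbounded, Step 2 is undefined, and with ε = 0 the loop can run forever. *)

(* Defs.v *)
(* MathComp / MathComp-Analysis *)
From HB Require Import structures.
From mathcomp Require Import all_boot all_order all_algebra.
From mathcomp Require Import all_classical all_reals all_analysis.

Set Implicit Arguments.
Unset Strict Implicit.
Unset Printing Implicit Defensive.

Import Order.TTheory GRing.Theory Num.Theory.
Import numFieldNormedType.Exports.

Local Open Scope classical_set_scope.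
Local Open Scope ring_scope.

Definition dotp (R : realType) (p : nat) (u v : 'cV[R]_p) : R :=
  (u^T *m v) ord0 ord0.

Definition dual_cone (R : realType) (k : nat) (K : set 'cV[R]_k)
    : set 'cV[R]_k :=
  [set beta | forall z, K z -> 0 <= dotp beta z].

Definition closed_convex_cone (R : realType) (k : nat) (K : set 'cV[R]_k)
    : Prop :=
  [/\ K !=set0, closed K, convex_set K
    & forall (t : R) (z : 'cV[R]_k), 0 <= t -> K z -> K (t *: z)].

Record micone (R : realType) (n k m : nat) := MICone {
  cone : set 'cV[R]_k;
  cost : 'cV[R]_k;
  Ax : 'M[R]_(m, n);
  Az : 'M[R]_(m, k);
  rhs : 'cV[R]_m;
  lob : 'cV[R]_n;
  upb : 'cV[R]_n }.

Section Problems.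
Variables (R : realType) (n k m : nat) (P : micone R n k m).

(* Integer vectors have type 'cV[int]_n; they enter the constraints through
   this embedding. *)
Definition intvec (x : 'cV[int]_n) : 'cV[R]_n := map_mx intr x.

Definition in_box (x : 'cV[int]_n) : Prop :=
  forall i, lob P i ord0 <= intvec x i ord0 <= upb P i ord0.

Definition linear_constraints (x : 'cV[int]_n) (z : 'cV[R]_k) : Prop :=
  Ax P *m intvec x + Az P *m z = rhs P /\ in_box x.

Definition micone_feasible (x : 'cV[int]_n) (z : 'cV[R]_k) : Prop :=
  linear_constraints x z /\ cone P z.

Definition micone_optimal (x : 'cV[int]_n) (z : 'cV[R]_k) : Prop :=
  micone_feasible x z /\
  forall x' z', micone_feasible x' z' -> dotp (cost P) z <= dotp (cost P) z'.

Definition micone_infeasible : Prop := forall x z, ~ micone_feasible x z.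

Definition mioa_feasible (T : set 'cV[R]_k) (x : 'cV[int]_n) (z : 'cV[R]_k)
    : Prop :=
  linear_constraints x z /\ forall beta, T beta -> 0 <= dotp beta z.

Definition mioa_optimal (T : set 'cV[R]_k) (x : 'cV[int]_n) (z : 'cV[R]_k)
    : Prop :=
  mioa_feasible T x z /\
  forall x' z', mioa_feasible T x' z' -> dotp (cost P) z <= dotp (cost P) z'.

Definition mioa_infeasible (T : set 'cV[R]_k) : Prop :=
  forall x z, ~ mioa_feasible T x z.

(* MIOA(T) may be feasible and unbounded below (e.g. for T empty), in which
   case there is no optimal solution for the algorithm to pick. *)
Definition mioa_solvable (T : set 'cV[R]_k) : Prop :=
  mioa_infeasible T \/ exists x z, mioa_optimal T x z.

Definition cp_rhs (x : 'cV[int]_n) : 'cV[R]_m := rhs P - Ax P *m intvec x.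

Definition cp_feasible (x : 'cV[int]_n) (z : 'cV[R]_k) : Prop :=
  Az P *m z = cp_rhs x /\ cone P z.

Definition cp_optimal (x : 'cV[int]_n) (z : 'cV[R]_k) : Prop :=
  cp_feasible x z /\
  forall z', cp_feasible x z' -> dotp (cost P) z <= dotp (cost P) z'.

Definition cp_infeasible (x : 'cV[int]_n) : Prop :=
  forall z, ~ cp_feasible x z.

(* The feasible set of the dual of CP(x) does not depend on x. *)
Definition dual_feasible (beta : 'cV[R]_k) (lambda : 'cV[R]_m) : Prop :=
  beta = cost P - (Az P)^T *m lambda /\ dual_cone (cone P) beta.

Definition dual_optimal (x : 'cV[int]_n) (beta : 'cV[R]_k)
    (lambda : 'cV[R]_m) : Prop :=
  dual_feasible beta lambda /\
  forall beta' lambda', dual_feasible beta' lambda' ->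
    dotp lambda' (cp_rhs x) <= dotp lambda (cp_rhs x).

Definition dual_unbounded (x : 'cV[int]_n) : Prop :=
  forall M : R, exists beta lambda,
    dual_feasible beta lambda /\ M < dotp lambda (cp_rhs x).

Definition dual_ray (x : 'cV[int]_n) (beta : 'cV[R]_k) (lambda : 'cV[R]_m)
    : Prop :=
  [/\ dual_cone (cone P) beta, beta = - ((Az P)^T *m lambda)
    & 0 < dotp lambda (cp_rhs x)].

Definition feasible_strong_duality (x : 'cV[int]_n) : Prop :=
  exists z beta lambda,
    [/\ cp_optimal x z, dual_optimal x beta lambda
      & dotp (cost P) z = dotp lambda (cp_rhs x)].

Definition infeasible_with_ray (x : 'cV[int]_n) : Prop :=
  [/\ cp_infeasible x, dual_unbounded x
    & exists beta lambda, dual_ray x beta lambda].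

End Problems.

Record oa_state (R : realType) (n k : nat) := OAState {
  zU : \bar R;
  zL : \bar R;
  cuts : set 'cV[R]_k;
  best : option ('cV[int]_n * 'cV[R]_k) }.

Section Algorithm.
Variables (R : realType) (n k m : nat) (P : micone R n k m) (eps : R).
(* The algorithm starts from T = T0; the textbook initialization is T0 = set0.
   With T0 = set0, MIOA(T0) has an optimal solution only if the cost is constant
   on the solution set of Az z = b - Ax x for each fixed x, which is why a
   general set of initial cuts is allowed. *)
Variable T0 : set 'cV[R]_k.

Local Notation state := (oa_state R n k).

Definition oa_init : state := OAState +oo%E -oo%E T0 None.

Definition oa_continues (s : state) : Prop := (eps%:E <= zU s - zL s)%E.

Definition oa_converged (s : state) : Prop := (zU s - zL s < eps%:E)%E.

(* [oa_step s x s'] is one full pass through the loop body, in which the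
   optimal solution chosen for MIOA(T) has integer part x.  It is a relation
   because the algorithm does not say which optimal solution, which optimal
   primal-dual pair or which ray is chosen. *)
Inductive oa_step (s : state) (x : 'cV[int]_n) : state -> Prop :=
| oa_step_feasible (zhat z beta : 'cV[R]_k) (lambda : 'cV[R]_m) :
    oa_continues s ->
    mioa_optimal P (cuts s) x zhat ->
    cp_optimal P x z ->
    dual_optimal P x beta lambda ->
    oa_step s x
      (let improved := ((dotp (cost P) z)%:E < zU s)%E in
       OAState (if improved then (dotp (cost P) z)%:E else zU s)
               (dotp (cost P) zhat)%:E
               (cuts s `|` [set beta])
               (if improved then Some (x, z) else best s))
| oa_step_infeasible (zhat beta : 'cV[R]_k) (lambda : 'cV[R]_m) :
    oa_continues s ->
    mioa_optimal P (cuts s) x zhat ->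
    cp_infeasible P x ->
    dual_ray P x beta lambda ->
    oa_step s x
      (OAState (zU s) (dotp (cost P) zhat)%:E (cuts s `|` [set beta]) (best s)).

(* [oa_run xs s]: some execution reaches s after [size xs] passes through the
   loop, having encountered successively the integer vectors listed in xs. *)
Inductive oa_run : seq 'cV[int]_n -> state -> Prop :=
| oa_run_init : oa_run [::] oa_init
| oa_run_step xs s x s' :
    oa_run xs s -> oa_step s x s' -> oa_run (rcons xs x) s'.

Definition oa_encountered (x : 'cV[int]_n) : Prop :=
  exists xs s zhat,
    [/\ oa_run xs s, oa_continues s & mioa_optimal P (cuts s) x zhat].

Definition oa_assumption : Prop :=
  forall x, oa_encountered x ->
    feasible_strong_duality P x \/ infeasible_with_ray P x.

Definition oa_terminated (s : state) : Prop :=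
  oa_converged s \/ mioa_infeasible P (cuts s).

(* The recorded best solution is feasible with value zU, and its value exceeds
   that of no feasible point by eps or more. *)
Definition returns_within_tolerance (s : state) : Prop :=
  exists x z,
    [/\ best s = Some (x, z), micone_feasible P x z,
        zU s = (dotp (cost P) z)%:E
      & forall x' z', micone_feasible P x' z' ->
          (zL s <= (dotp (cost P) z')%:E)%E /\
          dotp (cost P) z < dotp (cost P) z' + eps].

Definition returns_optimal (s : state) : Prop :=
  exists x z,
    [/\ best s = Some (x, z), micone_optimal P x z
      & zU s = (dotp (cost P) z)%:E].

End Algorithm.

(* Main.v *)
Require Import Defs.
From HB Require Import structures.
From mathcomp Require Import all_boot all_order all_algebra.
From mathcomp Require Import all_classical all_reals all_analysis.
From mathcomp Require Import zify lra.

Set Implicit Arguments.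
Unset Strict Implicit.
Unset Printing Implicit Defensive.

Import Order.TTheory GRing.Theory Num.Theory.
Import numFieldNormedType.Exports.

Local Open Scope classical_set_scope.
Local Open Scope ring_scope.

(** Each pass that chooses an integer vector [x] adds a cut that disposes of [x]
    for good.  If CP(x) is infeasible, the cut is a dual ray, and no point of
    MIOA(T) has integer part [x] any more ([ray_cuts_off]).  If CP(x) is
    feasible, the cut is a dual optimal solution; by strong duality every point
    of MIOA(T) with integer part [x] then costs at least the value of CP(x)
    ([dual_cut_bound], [strong_duality_value]), hence at least the upper bound
    zU.  Both facts are the invariant [run_cut_off].  Choosing [x] a second time
    thus gives zU <= zL, which stops the loop with an exact optimum
    ([run_repetition]), because zL bounds the problem from below as long as all
    cuts lie in the dual cone ([run_lower_bound]).  The box contains finitely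
    many integer vectors ([finite_in_box]), so the number of passes is bounded
    ([run_size_bound]).

    When there is no initial cut, a first pass is only possible if the cost is
    constant on the solution set of the linear constraints for each fixed
    integer vector, since an affine function bounded below on an affine space is
    constant ([mioa0_cost_constant]).  Then MIOA(T) is a minimization over
    finitely many values, hence solvable ([mioa0_solvable]), and the first pass
    with a feasible subproblem has zU = zL and ends the loop
    ([run0_invariant]); so there is no repetition at all and the result is
    exactly optimal whatever the tolerance.

    For general initial cuts, the value recorded is the value of CP(x) for some
    [x] in the box.  There are finitely many such values, so one tolerance lies
    below a gap between each of them that is not optimal and some feasible value
    ([uniform_exact_tolerance]). *)

(** * The scalar product *)

Section ScalarProduct.
Variable R : realType.

Lemma dotpNl p (u w : 'cV[R]_p) : dotp (- u) w = - dotp u w.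
Proof. by rewrite /dotp linearN mulNmx mxE. Qed.

Lemma dotpBl p (u v w : 'cV[R]_p) : dotp (u - v) w = dotp u w - dotp v w.
Proof. by rewrite /dotp linearB mulmxBl !mxE. Qed.

Lemma dotpDr p (u v w : 'cV[R]_p) : dotp u (v + w) = dotp u v + dotp u w.
Proof. by rewrite /dotp mulmxDr mxE. Qed.

Lemma dotpZr p (a : R) (u v : 'cV[R]_p) : dotp u (a *: v) = a * dotp u v.
Proof. by rewrite /dotp -scalemxAr mxE. Qed.

Lemma dotp_trmul p q (A : 'M[R]_(p, q)) (u : 'cV[R]_p) (v : 'cV[R]_q) :
  dotp (A^T *m u) v = dotp u (A *m v).
Proof. by rewrite /dotp trmx_mul trmxK mulmxA. Qed.

End ScalarProduct.

(** * Relaxations, dual cuts and the integer points of the box *)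

Section Relaxation.
Variables (R : realType) (n k m : nat) (P : micone R n k m).
Implicit Types (x : 'cV[int]_n) (z beta : 'cV[R]_k) (T : set 'cV[R]_k).

Lemma linear_constraintsE x z :
  linear_constraints P x z <-> in_box P x /\ Az P *m z = cp_rhs P x.
Proof.
rewrite /linear_constraints /cp_rhs; split=> [[h hb] | [hb h]]; split=> //.
- by rewrite -h addrC addKr.
- by rewrite h addrC subrK.
Qed.

Lemma micone_feasibleE x z :
  micone_feasible P x z <-> in_box P x /\ cp_feasible P x z.
Proof.
rewrite /micone_feasible /cp_feasible; split.
- by case=> /linear_constraintsE [].
- by case=> hb [hz hc]; split=> //; apply/linear_constraintsE.
Qed.

Lemma mioa_relaxation T x z : T `<=` dual_cone (cone P) ->
  micone_feasible P x z -> mioa_feasible P T x z.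
Proof. by move=> hT [hl hz]; split=> // beta /hT; apply. Qed.

Lemma mioa_feasible_antimono T T' x z : T `<=` T' ->
  mioa_feasible P T' x z -> mioa_feasible P T x z.
Proof. by move=> hT [hl hz]; split=> // beta /hT; apply: hz. Qed.

Lemma ray_cuts_off T x z beta lambda : dual_ray P x beta lambda -> T beta ->
  ~ mioa_feasible P T x z.
Proof.
move=> [_ -> hpos] hT [/linear_constraintsE[_ hz] /(_ _ hT)].
by rewrite dotpNl dotp_trmul hz oppr_ge0 leNgt hpos.
Qed.

Lemma dual_cut_bound T x z beta lambda : dual_feasible P beta lambda ->
  T beta -> mioa_feasible P T x z ->
  dotp lambda (cp_rhs P x) <= dotp (cost P) z.
Proof.
move=> [-> _] hT [/linear_constraintsE[_ hz] /(_ _ hT)].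
by rewrite dotpBl dotp_trmul hz subr_ge0.
Qed.

Lemma cp_optimal_value x z z' : cp_optimal P x z -> cp_optimal P x z' ->
  dotp (cost P) z = dotp (cost P) z'.
Proof.
by move=> [hz ho] [hz' ho']; apply/eqP; rewrite eq_le ho //= ho'.
Qed.

(** The property (a) speaks of one primal-dual pair; the absence of a duality
    gap then holds for every pair of optimal solutions. *)
Lemma strong_duality_value x z beta lambda : feasible_strong_duality P x ->
  cp_optimal P x z -> dual_optimal P x beta lambda ->
  dotp (cost P) z = dotp lambda (cp_rhs P x).
Proof.
move=> [z1 [beta1 [lambda1 [hz1 [hd1 ho1] heq]]]] hz [hd ho].
rewrite (cp_optimal_value hz hz1) heq.
by apply/eqP; rewrite eq_le (ho _ _ hd1) (ho1 _ _ hd).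
Qed.

Lemma finite_in_box : finite_set [set x | in_box P x].
Proof.
(* B bounds the absolute values of all coordinates; adding N makes them
   nonnegative, which encodes the vector as a function into a finite type. *)
pose B := \sum_i (`|lob P i ord0| + `|upb P i ord0|).
pose N := Num.bound B.
pose f (g : {ffun 'I_n -> 'I_(2 * N).+1}) : 'cV[int]_n :=
  \col_i ((g i : nat)%:Z - N%:Z).
apply: (@sub_finite_set _ _ (range f)); last first.
  by apply: finite_image; exact: finite_finset.
move=> x /= hx.
have B_ge i : `|lob P i ord0| + `|upb P i ord0| <= B.
  rewrite /B (bigD1 i) //= lerDl; apply: sumr_ge0 => j _.
  by rewrite addr_ge0.
have xN i : (`|x i ord0| < N%:Z)%R.
  rewrite -(ltr_int R) intr_norm.
  apply: le_lt_trans (archi_boundP (le_trans _ (B_ge i))); last first.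
    by rewrite addr_ge0.
  apply: le_trans (B_ge i).
  have := hx i; rewrite mxE => /andP[h1 h2].
  have := ler_norm (upb P i ord0); have := ler_norm (- lob P i ord0).
  rewrite normrN => h3 h4.
  have h5 := normr_ge0 (upb P i ord0); have h6 := normr_ge0 (lob P i ord0).
  rewrite ler_norml; apply/andP; split; lra.
exists [ffun i => inord (absz (x i ord0 + N%:Z))] => //.
apply/matrixP => i j; rewrite (ord1 j : j = ord0) !mxE ffunE.
have := xN i => {}xN.
by move: (x i ord0) xN => y yN; rewrite inordK; lia.
Qed.

End Relaxation.

(** * Invariants of the executions *)

Section Execution.
Variables (R : realType) (n k m : nat) (P : micone R n k m) (eps : R).
Variable T0 : set 'cV[R]_k.
Implicit Types (x : 'cV[int]_n) (xs : seq 'cV[int]_n) (s : oa_state R n k).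

Lemma oa_stepE s x s' : oa_step P eps s x s' ->
  exists2 zhat, mioa_optimal P (cuts s) x zhat &
    [/\ oa_continues eps s, zL s' = (dotp (cost P) zhat)%:E,
        cuts s `<=` cuts s' & (zU s' <= zU s)%E].
Proof.
case=> [zhat z beta lambda hc hm hz hd | zhat beta lambda hc hm hi hr];
  exists zhat => //; split=> //=; try by move=> y hy; left.
by case: ifPn => // /ltW.
Qed.

Lemma not_oa_continues s : ~ oa_continues eps s <-> oa_converged eps s.
Proof.
rewrite /oa_continues /oa_converged ltNge; split=> [/negP //|/negP //].
Qed.

Lemma run_in_box xs s : oa_run P eps T0 xs s ->
  forall x, x \in xs -> in_box P x.
Proof.
elim=> [|{}xs {}s x s' _ ih] // /oa_stepE[zhat [[[_ hb] _] _] _] y.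
by rewrite mem_rcons in_cons => /orP[/eqP ->|/ih].
Qed.

Lemma run_zL_ltey xs s : oa_run P eps T0 xs s -> (zL s < +oo)%E.
Proof.
by elim=> [|{}xs {}s x s' _ _ /oa_stepE[zhat _ [_ -> _ _]]] //; exact: ltry.
Qed.

(** Either no solution has been recorded, or the recorded one solves the
    continuous subproblem of its own integer part. *)
Lemma run_incumbent xs s : oa_run P eps T0 xs s ->
  zU s = +oo%E \/ exists x z, [/\ best s = Some (x, z), in_box P x,
    cp_optimal P x z & zU s = (dotp (cost P) z)%:E].
Proof.
elim=> [|{}xs {}s x s' _ ih hs]; first by left.
case: hs => [zhat z beta lambda hc [[[_ hb] _] _] hz hd |] //=.
by case: ifPn => // _; right; exists x, z.
Qed.

(** A first pass can only take place if MIOA has an optimal solution for the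
    initial cuts. *)
Lemma run_opened xs s : oa_run P eps T0 xs s ->
  s = oa_init n T0 \/ exists x z, mioa_optimal P T0 x z.
Proof.
elim=> [|{}xs {}s x s' _ ih /oa_stepE[zhat hm _]]; first by left.
right; case: ih hm => [-> //= hm|//]; by exists x, zhat.
Qed.

Hypothesis T0_valid : T0 `<=` dual_cone (cone P).

Lemma run_cuts_valid xs s : oa_run P eps T0 xs s ->
  cuts s `<=` dual_cone (cone P).
Proof.
elim=> [|{}xs {}s x s' _ ih] //.
case=> [zhat z beta lambda _ _ _ [[_ hd] _] | zhat beta lambda _ _ _ [hd _ _]];
  by move=> y /= [/ih|->].
Qed.

Lemma run_lower_bound xs s : oa_run P eps T0 xs s ->
  forall x z, micone_feasible P x z -> (zL s <= (dotp (cost P) z)%:E)%E.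
Proof.
case=> [|{}xs {}s x s' hr /oa_stepE[zhat [_ ho] [_ -> _ _]]] y z hy /=.
  exact: leNye.
rewrite lee_fin; apply: (ho y); apply: mioa_relaxation hy.
exact: run_cuts_valid hr.
Qed.

Lemma run_mioa_infeasible xs s : oa_run P eps T0 xs s ->
  mioa_infeasible P (cuts s) -> micone_infeasible P.
Proof.
move=> hr hi x z hz; apply: (hi x z); apply: mioa_relaxation hz.
exact: run_cuts_valid hr.
Qed.

(** The two bounds meet only at an exact optimum. *)
Lemma run_closed_gap xs s : oa_run P eps T0 xs s -> 0 < eps ->
  (zU s <= zL s)%E -> oa_converged eps s /\ returns_optimal P s.
Proof.
move=> hr eps0 hle; have hL := run_zL_ltey hr.
case: (run_incumbent hr) => [hU|[x [z [hb hx hz hU]]]].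
  by move: (le_lt_trans hle hL); rewrite hU ltxx.
have hlow := run_lower_bound hr.
have hf : micone_feasible P x z by apply/micone_feasibleE; split=> //; case: hz.
split.
- rewrite /oa_converged; apply: le_lt_trans (_ : 0%:E < _)%E; last by rewrite lte_fin.
  have /eqP -> : zU s == zL s by rewrite eq_le hle hU (hlow _ _ hf).
  case: (zL s) hL hle (hlow _ _ hf) => [r| |] //=; rewrite hU //.
  by move=> *; rewrite subee.
- exists x, z; split=> //; split=> // x' z' hz'.
  by have := le_trans hle (hlow _ _ hz'); rewrite hU lee_fin.
Qed.

Lemma run_within_tolerance xs s : oa_run P eps T0 xs s ->
  oa_converged eps s -> returns_within_tolerance P eps s.
Proof.
rewrite /oa_converged => hr hc; have hL := run_zL_ltey hr.
have hlow := run_lower_bound hr.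
case: (run_incumbent hr) => [hU|[x [z [hb hx hz hU]]]].
  by move: hc hL; rewrite hU; case: (zL s).
have hf : micone_feasible P x z by apply/micone_feasibleE; split=> //; case: hz.
exists x, z; split=> // x' z' hz'; split; first exact: hlow hz'.
move: hc hL (hlow _ _ hz'); rewrite hU; case: (zL s) => [r| |] //=.
by rewrite -EFinB lte_fin lee_fin; lra.
Qed.

Hypothesis assum : oa_assumption P eps T0.

(** The central invariant: an integer vector already encountered is excluded
    from MIOA(T) if its subproblem is infeasible, and cannot improve on the
    incumbent otherwise. *)
Lemma run_cut_off xs s : oa_run P eps T0 xs s ->
  forall x z, x \in xs -> mioa_feasible P (cuts s) x z ->
  ~ cp_infeasible P x /\ (zU s <= (dotp (cost P) z)%:E)%E.
Proof.
elim=> [|{}xs {}s x s' hr ih hs] // y z; rewrite mem_rcons in_cons.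
have [zhat hm [hc _ hsub hU]] := oa_stepE hs.
case/orP=> [/eqP ->|hy] hz; last first.
  have [hn hle] := ih y z hy (mioa_feasible_antimono hsub hz).
  by split=> //; exact: le_trans hle.
have henc : oa_encountered P eps T0 x by exists xs, s, zhat.
case: hs hz {hU hsub} => [zhat' z' beta lambda _ _ hz' hd|
  zhat' beta lambda _ _ hi hd] hz; last first.
  by case: (ray_cuts_off hd _ hz); right.
split=> [hi|]; first by case: hz' => /hi.
have hsd : feasible_strong_duality P x.
  by case: (assum henc) => // -[hi]; case: hz' => /hi.
have hv : dotp (cost P) z' <= dotp (cost P) z.
  rewrite (strong_duality_value hsd hz' hd).
  by apply: dual_cut_bound (proj1 hd) _ hz; right.
rewrite /=; case: ifPn => [_|]; first by rewrite lee_fin.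
by rewrite -leNgt => /le_trans; apply; rewrite lee_fin.
Qed.

Lemma repetition_closes_gap xs s x s' : oa_run P eps T0 xs s ->
  oa_step P eps s x s' -> x \in xs -> (zU s' <= zL s')%E.
Proof.
move=> hr /oa_stepE[zhat [hf _] [_ -> _ hU]] hx.
by have [_] := run_cut_off hr hx hf; exact: le_trans.
Qed.

Lemma run_progress xs s : oa_run P eps T0 xs s -> mioa_solvable P (cuts s) ->
  oa_terminated P eps s \/ exists x s', oa_step P eps s x s'.
Proof.
move=> hr [hi|[x [zhat hm]]]; first by left; right.
have [hc|/not_oa_continues] := pselect (oa_continues eps s); last by left; left.
right; exists x.
have henc : oa_encountered P eps T0 x by exists xs, s, zhat.
case: (assum henc) => [[z [beta [lambda [hz hd _]]]]|[hi _ [beta [lambda hd]]]].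
- by eexists; exact: (oa_step_feasible hc hm hz hd).
- by eexists; exact: (oa_step_infeasible hc hm hi hd).
Qed.

Lemma run_infeasible_once xs s : oa_run P eps T0 xs s ->
  forall x, x \in xs -> cp_infeasible P x -> count_mem x xs = 1%N.
Proof.
elim=> [|{}xs {}s x s' hr ih hs] // y hy hi.
have [zhat [hf _] _] := oa_stepE hs.
rewrite -cats1 count_cat /= addn0.
have [eyx|nyx] := eqVneq x y.
  subst y; rewrite (count_memPn _) //; apply/negP => hx.
  by have [] := run_cut_off hr hx hf.
rewrite ih // ?addn0 //.
by move: hy; rewrite mem_rcons in_cons eq_sym (negPf nyx).
Qed.

Hypothesis eps_gt0 : 0 < eps.

Lemma run_continues_uniq xs s : oa_run P eps T0 xs s ->
  oa_continues eps s -> uniq xs.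
Proof.
elim=> [|{}xs {}s x s' hr ih hs hc] //; rewrite rcons_uniq.
have [zhat _ [hc' _ _ _]] := oa_stepE hs.
rewrite ih // andbT; apply/negP => /(repetition_closes_gap hr hs).
move/(run_closed_gap (oa_run_step hr hs) eps_gt0) => -[].
by move/not_oa_continues.
Qed.

Lemma run_repetition xs s : oa_run P eps T0 xs s -> ~~ uniq xs ->
  oa_converged eps s /\ returns_optimal P s.
Proof.
case=> [|{}xs {}s x s' hr hs] //; rewrite rcons_uniq.
have [zhat _ [hc _ _ _]] := oa_stepE hs.
rewrite (run_continues_uniq hr hc) andbT negbK => hx.
apply: run_closed_gap (oa_run_step hr hs) eps_gt0 _.
exact: repetition_closes_gap hr hs hx.
Qed.

Lemma run_size_bound :
  exists N : nat, forall xs s, oa_run P eps T0 xs s -> (size xs <= N)%N.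
Proof.
have /finite_seqP[l hl] := finite_in_box P.
exists (size l).+1 => xs s [|{}xs {}s x s' hr /oa_stepE[_ _ [hc _ _ _]]] //.
rewrite size_rcons ltnS; apply: uniq_leq_size (run_continues_uniq hr hc) _.
move=> y /(run_in_box hr) hy.
by have : [set x | in_box P x] y by []; rewrite hl.
Qed.

End Execution.

(** * Executions started without cuts *)

Section NoInitialCut.
Variables (R : realType) (n k m : nat) (P : micone R n k m).

(** An affine function bounded below on an affine space is constant. *)
Lemma mioa0_cost_constant x0 z0 x z z' : mioa_optimal P set0 x0 z0 ->
  linear_constraints P x z -> linear_constraints P x z' ->
  dotp (cost P) z = dotp (cost P) z'.
Proof.
move=> [_ ho] /linear_constraintsE[hx hz] /linear_constraintsE[_ hz'].
have hlow t : dotp (cost P) z0 <=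
    dotp (cost P) z + t * (dotp (cost P) z' - dotp (cost P) z).
  have -> : dotp (cost P) z + t * (dotp (cost P) z' - dotp (cost P) z) =
      dotp (cost P) (z + t *: (z' + (-1) *: z)).
    by rewrite dotpDr dotpZr dotpDr dotpZr mulN1r.
  apply: (ho x); split=> //; apply/linear_constraintsE; split=> //.
  rewrite mulmxDr -scalemxAr mulmxDr -scalemxAr hz hz'.
  by rewrite scaleN1r subrr scaler0 addr0.
set d := _ - _ in hlow.
have [d0|d0] := eqVneq d 0; first by move/eqP: d0; rewrite subr_eq0 => /eqP.
(* the cost at this parameter is one less than the lower bound *)
have := hlow ((dotp (cost P) z0 - dotp (cost P) z - 1) / d).
by rewrite divfK //; lra.
Qed.

(** With one cost value per integer vector, MIOA(T) minimizes over a finite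
    set of values. *)
Lemma mioa0_solvable (T : set 'cV[R]_k) :
  mioa_solvable P set0 -> mioa_solvable P T.
Proof.
have hsub : set0 `<=` T by [].
case=> [hi|[x0 [z0 hm]]].
  by left=> x z /(mioa_feasible_antimono hsub) /hi.
have [hi|] := pselect (mioa_infeasible P T); first by left.
move=> /existsNP[x1 /existsNP[z1 /contrapT h1]]; right.
have /finite_seqP[l hl] := finite_in_box P.
have inl x z : mioa_feasible P T x z -> x \in l.
  by move=> [[_ hb] _]; have : [set x | in_box P x] x by []; rewrite hl.
(* a feasible continuous part for each integer vector that has one *)
pose zc x := xget z1 [set z | mioa_feasible P T x z].
have zcP x z : mioa_feasible P T x z -> mioa_feasible P T x (zc x).
  by move=> hz; apply: (xgetPex z1 (P := [set z | mioa_feasible P T x z])); exists z.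
pose feas (i : seq_sub l) := `[< mioa_feasible P T (ssval i) (zc (ssval i)) >].
have feas1 : feas (SeqSub (inl _ _ h1)) by apply/asboolP; exact: zcP h1.
case: (arg_minP (fun i => dotp (cost P) (zc (ssval i))) feas1) => i /asboolP hi ho.
exists (ssval i), (zc (ssval i)); split=> // x z hz; have hz' := zcP _ _ hz.
rewrite (mioa0_cost_constant hm (proj1 hz) (proj1 hz')).
by apply: (ho (SeqSub (inl _ _ hz))); exact/asboolP.
Qed.

Variable eps : R.
Hypotheses (eps_gt0 : 0 < eps) (assum : oa_assumption P eps set0).

Let set0_valid : set0 `<=` dual_cone (cone P).
Proof. by []. Qed.

(** All passes but the last meet infeasible subproblems: a feasible one has the
    cost of the solution of MIOA(T) just found, so that the gap closes. *)
Lemma run0_invariant xs s : oa_run P eps set0 xs s -> uniq xs /\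
  ((zU s = +oo%E /\ forall x, x \in xs -> cp_infeasible P x) \/
   (zU s <= zL s)%E).
Proof.
elim=> [|{}xs {}s x s' hr [hu ih] hs]; first by split=> //; left.
have [zhat hm [hc hL _ _]] := oa_stepE hs.
have {ih} [hU hinf] : zU s = +oo%E /\ forall x, x \in xs -> cp_infeasible P x.
  case: ih => // /(run_closed_gap set0_valid hr eps_gt0) [hconv _].
  by move/not_oa_continues: hconv => /(_ hc).
split.
  rewrite rcons_uniq hu andbT; apply/negP => hx.
  have [hn _] := run_cut_off assum hr hx (proj1 hm).
  exact: hn (hinf _ hx).
have [x0 [z0 hm0]] : exists x0 z0, mioa_optimal P set0 x0 z0.
  by case: (run_opened hr) hm => [-> hm|//]; exists x, zhat.
case: hs hL => [zhat' z beta lambda _ _ hz _|zhat' beta lambda _ _ hi _] /= hL.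
- right; rewrite hU ltry hL lee_fin.
  rewrite (mioa0_cost_constant hm0 (x := x) (z := z) (z' := zhat)) //.
  + apply/linear_constraintsE; split; last by case: hz => -[].
    by case: hm => [[[]]].
  + by case: hm => [[]].
- left; split=> // y; rewrite mem_rcons in_cons => /orP[/eqP -> //|].
  exact: hinf.
Qed.

Lemma run0_returns_optimal xs s : oa_run P eps set0 xs s ->
  oa_converged eps s -> returns_optimal P s.
Proof.
move=> hr hc; case: (run0_invariant hr) => _ [[hU _]|hle].
  move: hc (run_zL_ltey hr); rewrite /oa_converged hU; case: (zL s) => //.
by have [] := run_closed_gap set0_valid hr eps_gt0 hle.
Qed.

End NoInitialCut.

(** * Small tolerances *)

Section SmallTolerance.
Variables (R : realType) (n k m : nat) (P : micone R n k m).

(** If the value of CP(x) exceeds the cost of some feasible point, the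
    difference is a tolerance at which [x] is recognized as suboptimal; if there
    is no such point, any tolerance will do.  Neither attainment nor strong
    duality is needed for the integer part of the better point, which need not
    have been encountered. *)
Lemma exact_tolerance x : exists2 e : R, 0 < e & forall z eps,
  in_box P x -> cp_optimal P x z -> eps <= e ->
  (forall x' z', micone_feasible P x' z' ->
     dotp (cost P) z < dotp (cost P) z' + eps) ->
  micone_optimal P x z.
Proof.
have [[z [x' [z' [hz hz' hlt]]]]|hno] := pselect (exists z x' z',
    [/\ cp_optimal P x z, micone_feasible P x' z'
      & dotp (cost P) z' < dotp (cost P) z]).
- exists (dotp (cost P) z - dotp (cost P) z'); first by rewrite subr_gt0.
  move=> z1 eps _ hz1 he /(_ _ _ hz'); rewrite (cp_optimal_value hz1 hz); lra.
- exists 1 => // z eps hb hz _ _; split.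
    by apply/micone_feasibleE; split=> //; case: hz.
  move=> x' z' hz'; rewrite leNgt; apply/negP => hlt.
  by apply: hno; exists z, x', z'.
Qed.

Lemma uniform_exact_tolerance : exists2 eps0 : R, 0 < eps0 &
  forall x z eps, in_box P x -> cp_optimal P x z -> eps <= eps0 ->
  (forall x' z', micone_feasible P x' z' ->
     dotp (cost P) z < dotp (cost P) z' + eps) ->
  micone_optimal P x z.
Proof.
have /finite_seqP[l hl] := finite_in_box P.
suff [e e0 he] : exists2 e : R, 0 < e & forall x z eps, x \in l ->
    in_box P x -> cp_optimal P x z -> eps <= e ->
    (forall x' z', micone_feasible P x' z' ->
      dotp (cost P) z < dotp (cost P) z' + eps) -> micone_optimal P x z.
  exists e => // x z eps hx; apply: he => //.
  by have : [set x | in_box P x] x by []; rewrite hl.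
elim: l {hl} => [|y l [e e0 he]]; first by exists 1.
have [e' e'0 he'] := exact_tolerance y.
exists (Num.min e e'); first by rewrite lt_min e0.
move=> x z eps; rewrite in_cons le_min => /orP[/eqP ->|hx] hb hz /andP[h h'].
- exact: he' h'.
- exact: he h.
Qed.

End SmallTolerance.

Theorem mainTheorem1 (R : realType) (n k m : nat) (P : micone R n k m)
    (hK : closed_convex_cone (cone P)) :
  (* only finitely many integer vectors are possible *)
  finite_set [set x | in_box P x] /\
  (* the algorithm initialized with no cut *)
  (forall eps : R, 0 < eps -> oa_assumption P eps set0 ->
    (* the integer vectors chosen are possible ones and do not repeat *)
    (forall xs s, oa_run P eps set0 xs s ->
       uniq xs /\ forall x, x \in xs -> in_box P x) /\
    (* the number of passes through the loop is bounded *)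
    (exists N : nat, forall xs s, oa_run P eps set0 xs s ->
       (size xs <= N)%N) /\
    (* an execution can be continued until it has terminated *)
    (forall xs s, oa_run P eps set0 xs s -> mioa_solvable P set0 ->
       oa_terminated P eps s \/ exists x s', oa_step P eps s x s') /\
    (* the outcome is correct *)
    (forall xs s, oa_run P eps set0 xs s -> mioa_infeasible P (cuts s) ->
       micone_infeasible P) /\
    (forall xs s, oa_run P eps set0 xs s -> oa_converged eps s ->
       returns_optimal P s)) /\
  (* the algorithm initialized with arbitrary valid cuts *)
  (forall (T0 : set 'cV[R]_k) (eps : R), T0 `<=` dual_cone (cone P) ->
    0 < eps -> oa_assumption P eps T0 ->
    (forall xs s, oa_run P eps T0 xs s -> forall x, x \in xs -> in_box P x) /\
    (* no repetition as long as the loop has not ended *)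
    (forall xs s, oa_run P eps T0 xs s -> oa_continues eps s -> uniq xs) /\
    (* a repetition in the last pass stops the loop at an exact optimum *)
    (forall xs s, oa_run P eps T0 xs s -> ~~ uniq xs ->
       oa_converged eps s /\ returns_optimal P s) /\
    (* a vector whose subproblem is infeasible never repeats *)
    (forall xs s, oa_run P eps T0 xs s -> forall x, x \in xs ->
       cp_infeasible P x -> count_mem x xs = 1%N) /\
    (exists N : nat, forall xs s, oa_run P eps T0 xs s -> (size xs <= N)%N) /\
    (forall xs s, oa_run P eps T0 xs s -> mioa_solvable P (cuts s) ->
       oa_terminated P eps s \/ exists x s', oa_step P eps s x s') /\
    (forall xs s, oa_run P eps T0 xs s -> mioa_infeasible P (cuts s) ->
       micone_infeasible P) /\
    (forall xs s, oa_run P eps T0 xs s -> oa_converged eps s ->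
       returns_within_tolerance P eps s)) /\
  (* for small enough tolerances the solution returned is exactly optimal *)
  (exists2 eps0 : R, 0 < eps0 &
     forall (T0 : set 'cV[R]_k) (eps : R), T0 `<=` dual_cone (cone P) ->
     0 < eps -> eps <= eps0 -> oa_assumption P eps T0 ->
     forall xs s, oa_run P eps T0 xs s -> oa_converged eps s ->
       returns_optimal P s).
Proof.
have set0_valid : set0 `<=` dual_cone (cone P) by [].
split; first exact: finite_in_box.
split=> [eps e0 ha|].
  split.
    by move=> xs s hr; split; [case: (run0_invariant e0 ha hr)|exact: run_in_box hr].
  split; first exact: run_size_bound.
  split.
    by move=> xs s hr hs; apply: (run_progress ha hr); exact: mioa0_solvable.
  split=> xs s hr; first exact: run_mioa_infeasible hr.
  exact: run0_returns_optimal hr.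
split=> [T0 eps hT e0 ha|].
  split; first by move=> xs s; exact: run_in_box.
  split; first by move=> xs s; exact: run_continues_uniq.
  split; first by move=> xs s; exact: run_repetition.
  split; first by move=> xs s; exact: run_infeasible_once.
  split; first exact: run_size_bound.
  split; first by move=> xs s; exact: run_progress.
  split=> xs s hr; first exact: run_mioa_infeasible hr.
  exact: run_within_tolerance hr.
have [eps0 e0 he] := uniform_exact_tolerance P.
exists eps0 => // T0 eps hT _ hle _ xs s hr hc.
have [x [z [hb hf hU htol]]] := run_within_tolerance hT hr hc.
case: (run_incumbent hr) => [|[x' [z' [hb' hx hz _]]]]; first by rewrite hU.
move: hb'; rewrite hb => -[ex ez]; subst x' z'.
exists x, z; split=> //; apply: he hx hz hle _ => x' z' /htol[_].
by [].
Qed.
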